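(* Let $f_1:\mathbb{R}^m\to(-\infty,+\infty]$ be proper convex lower semi-continuous, let $B\in\mathbb{R}^{m\times d}$ have full row rank, and let $f_2(x)=\frac1n\sum_{i=1}^n\phi_i(x)$ with each $\phi_i:\mathbb{R}^d\to\mathbb{R}$ smooth and convex, $f_2$ being $\nu$-strongly convex ($\nu>0$) with $\frac1\beta$-Lipschitz gradient ($\beta>0$). Let $x^*$ be a minimizer of $f_1(Bx)+f_2(x)$ and $v^*\in\mathbb{R}^m$ such that for every $k$, with $h_k(x)=\frac{\lambda}{\gamma_k}f_1(\frac{\gamma_k}{\lambda}x)$, $$v^*=(I-\mathrm{Prox}_{h_k})\Big(\tfrac{\lambda}{\gamma_k}B\big(x^*-\gamma_k\nabla f_2(x^* )\big)+(I-\lambda BB^T)v^*\Big),\qquad x^*=x^*-\gamma_k\nabla f_2(x^* )-\gamma_kB^Tv^*.$$ Let $(x_k,v_k)$ be generated by Algorithm 1 (described in the context) with $c>0$, $\alpha\in(0,1]$, $0<\lambda<1/\rho_{\max}(BB^T)$, and assume there exist $C_1,C_2>0$ such that for all $k$, $\mathbb{E}^{(k+1)}\big(\|\nabla f_2^{[i_k]}(x_k)-\nabla f_2(x_k)\|_2^2\big)\le C_1\mathbb{E}^{(k)}(\|x_k\|_2^2)+C_2$. Let $k_0>0$ be an integer with $\gamma_{k_0}\le\min\{\frac{\beta\nu}{2(\nu+2C_1\beta)},\frac{\lambda\rho_{\min}(BB^T)}{\nu}\}$. Then, with $a_k=\mathbb{E}^{(k)}\big(\|x_k-x^*\|_2^2+\frac{\gamma_k^2}{\lambda}\|v_k-v^*\|_2^2\big)$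 and $M_1=4C_1\|x^*\|_2^2+2C_2$, $$a_{k+1}\le(1-\nu\gamma_k)a_k+\gamma_k^2M_1\qquad\forall k\ge k_0.$$
   Context: $\mathrm{Prox}_f(y)=\arg\min_x\{f(x)+\frac12\|x-y\|_2^2\}$; $\rho_{\max}(BB^T),\rho_{\min}(BB^T)$ are the largest and smallest eigenvalues of $BB^T$. Fix a batch size $p$ dividing $n$; for $i\in\{1,\dots,n/p\}$, $\nabla f_2^{[i]}(x)=\frac1p\sum_{j=(i-1)p+1}^{ip}\nabla\phi_j(x)$. Algorithm 1: choose $x_1\in\mathbb{R}^d$, $v_1\in\mathbb{R}^m$; for $k=1,2,\dots$: $\gamma_k=c/k^\alpha$; draw $i_k$ from $\{1,\dots,n/p\}$, each with probability $p/n$, independently of the past; $x_{k+1/2}=x_k-\gamma_k\nabla f_2^{[i_k]}(x_k)$; $v_{k+1}=\frac{\lambda}{\gamma_k}\big(I-\mathrm{Prox}_{\frac{\gamma_k}{\lambda}f_1}\big)\big(Bx_{k+1/2}+(I-\lambda BB^T)\frac{\gamma_k}{\lambda}v_k\big)$; $x_{k+1}=x_{k+1/2}-\gamma_kB^Tv_{k+1}$. $\mathbb{E}^{(k)}$ denotes expectation with respect to all random indices drawn up to the $k$-th iterate. *)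

(* Defs.v *)
From HB Require Import structures.
From mathcomp Require Import all_boot all_order all_algebra.
From mathcomp Require Import all_classical all_reals all_analysis.
Set Implicit Arguments. Unset Strict Implicit. Unset Printing Implicit Defensive.
Import Order.TTheory GRing.Theory Num.Theory.
Import numFieldNormedType.Exports.
Local Open Scope classical_set_scope.
Local Open Scope ring_scope.

Section Defs.
Variable R : realType.

Definition dotv (d : nat) (x y : 'cV[R]_d) : R := \sum_(j < d) x j 0 * y j 0.
Definition sqnorm (d : nat) (x : 'cV[R]_d) : R := dotv x x.
Definition norm2 (d : nat) (x : 'cV[R]_d) : R := Num.sqrt (sqnorm x).

Definition proper_fun (m : nat) (f : 'cV[R]_m -> \bar R) : Prop :=
  (forall x, f x != -oo%E) /\ (exists x, f x \is a fin_num).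

Definition convex_efun (m : nat) (f : 'cV[R]_m -> \bar R) : Prop :=
  forall (x y : 'cV[R]_m) (t : R), 0 < t < 1 ->
    (f (t *: x + (1 - t) *: y)%R <= t%:E * f x + (1 - t)%:E * f y)%E.

Definition convex_rfun (d : nat) (f : 'cV[R]_d -> R) : Prop :=
  forall (x y : 'cV[R]_d) (t : R), 0 <= t <= 1 ->
    f (t *: x + (1 - t) *: y) <= t * f x + (1 - t) * f y.

Definition strongly_convex (d : nat) (nu : R) (f : 'cV[R]_d -> R) : Prop :=
  convex_rfun (fun x => f x - nu / 2 * sqnorm x).

(** Proximity operator: Prox_g(y) = argmin_x { g x + 1/2 ||x - y||^2 }
    (the minimizer exists and is unique for proper convex lsc g;
    xget picks it). *)
Definition Prox (m : nat) (g : 'cV[R]_m -> \bar R) (y : 'cV[R]_m) : 'cV[R]_m :=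
  xget 0 [set p | forall x,
     (g p + (sqnorm (p - y) / 2)%:E <= g x + (sqnorm (x - y) / 2)%:E)%E].

Definition is_max_eigenvalue (m : nat) (A : 'M[R]_m) (r : R) : Prop :=
  eigenvalue A r /\ forall a, eigenvalue A a -> a <= r.
Definition is_min_eigenvalue (m : nat) (A : 'M[R]_m) (r : R) : Prop :=
  eigenvalue A r /\ forall a, eigenvalue A a -> r <= a.

Definition gamma (c alpha : R) (k : nat) : R := c / (k%:R `^ alpha).

(** mini-batch gradient: batches are indexed 0-based, batch j consists of
    the (0-based) components j*p, ..., j*p + p - 1, i.e. the paper's batch
    i = j+1 consisting of phi_{(i-1)p+1}, ..., phi_{ip}. *)
Definition batch_grad (p d : nat) (gphi : nat -> 'cV[R]_d -> 'cV[R]_d)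
  (j : nat) (x : 'cV[R]_d) : 'cV[R]_d :=
  p%:R^-1 *: \sum_(l < p) gphi (j * p + l)%N x.

Definition full_grad (n d : nat) (gphi : nat -> 'cV[R]_d -> 'cV[R]_d)
  (x : 'cV[R]_d) : 'cV[R]_d := n%:R^-1 *: \sum_(i < n) gphi i x.

Definition alg_step (p d m : nat) (gphi : nat -> 'cV[R]_d -> 'cV[R]_d)
  (f1 : 'cV[R]_m -> \bar R) (B : 'M[R]_(m, d)) (c alpha lam : R)
  (k : nat) (st : 'cV[R]_d * 'cV[R]_m) (j : nat) : 'cV[R]_d * 'cV[R]_m :=
  let g := gamma c alpha k in
  let xh := st.1 - g *: batch_grad p gphi j st.1 in
  let w := B *m xh + (1%:M - lam *: (B *m B^T)) *m ((g / lam) *: st.2) in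
  let v' := (lam / g) *: (w - Prox (fun u => ((g / lam)%:E * f1 u)%E) w) in
  (xh - g *: (B^T *m v'), v').

Fixpoint alg_run (p d m : nat) (gphi : nat -> 'cV[R]_d -> 'cV[R]_d)
  (f1 : 'cV[R]_m -> \bar R) (B : 'M[R]_(m, d)) (c alpha lam : R)
  (k : nat) (st : 'cV[R]_d * 'cV[R]_m) (s : seq nat) : 'cV[R]_d * 'cV[R]_m :=
  match s with
  | [::] => st
  | j :: s' => alg_run p gphi f1 B c alpha lam k.+1
                 (alg_step p gphi f1 B c alpha lam k st j) s'
  end.

(** (x_k, v_k) as a function of the drawn indices (i_1, ..., i_{k-1})
    (given as a list of length k-1 of 0-based batch indices). *)
Definition iterate (p d m : nat) (gphi : nat -> 'cV[R]_d -> 'cV[R]_d)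
  (f1 : 'cV[R]_m -> \bar R) (B : 'M[R]_(m, d)) (c alpha lam : R)
  (x1 : 'cV[R]_d) (v1 : 'cV[R]_m) (s : seq nat) : 'cV[R]_d * 'cV[R]_m :=
  alg_run p gphi f1 B c alpha lam 1 (x1, v1) s.

(** E^{(k)}: expectation over the i.i.d. uniform indices i_1, ..., i_{k-1}
    drawn from the N = n/p batches (each with probability 1/N). *)
Definition Ek (N k : nat) (g : seq nat -> R) : R :=
  (N%:R ^+ k.-1)^-1 * \sum_(t : (k.-1).-tuple 'I_N) g (map val t).

End Defs.

(* Main.v *)
(** Put [e = x - xs - g (G - H)] for the sampled gradient [G] at [x] and the full
    gradient [H] at [xs]. Firm nonexpansiveness of [I - Prox] and the spectral bounds
    [0 <= I - lam B B^T <= 1 - lam rho_min] bound the weighted distance to [(xs, vs)]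
    after one step by [|e|^2 + (1 - lam rho_min) (g^2 / lam) |v - vs|^2]. Averaging
    over the batch splits [|e|^2] into a deterministic gradient step, contracted by
    strong convexity and Baillon-Haddad cocoercivity, and a variance term of order
    [g^2 (C1 |x|^2 + C2)]. The step size condition lets the contraction absorb the
    part of the variance proportional to [|x - xs|^2]. *)

Require Import Defs.
From HB Require Import structures.
From mathcomp Require Import all_boot all_order all_algebra.
From mathcomp Require Import all_classical all_reals all_analysis.
From mathcomp Require Import finmap ring lra.
Import Order.TTheory GRing.Theory Num.Theory.
Import numFieldNormedType.Exports.
Local Open Scope classical_set_scope.
Local Open Scope ring_scope.

(** * Euclidean inner product and one-variable calculus *)

Lemma dotvC {R : realType} {d : nat} (x y : 'cV[R]_d) : dotv x y = dotv y x.
Proof. by apply: eq_bigr => j _; rewrite mulrC. Qed.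

Lemma dotvDl {R : realType} {d : nat} (x y z : 'cV[R]_d) :
  dotv (x + y) z = dotv x z + dotv y z.
Proof. by rewrite -big_split; apply: eq_bigr => j _; rewrite mxE mulrDl. Qed.

Lemma dotvDr {R : realType} {d : nat} (x y z : 'cV[R]_d) :
  dotv x (y + z) = dotv x y + dotv x z.
Proof. by rewrite dotvC dotvDl !(dotvC x). Qed.

Lemma dotvZl {R : realType} {d : nat} (a : R) (x y : 'cV[R]_d) :
  dotv (a *: x) y = a * dotv x y.
Proof. by rewrite mulr_sumr; apply: eq_bigr => j _; rewrite mxE mulrA. Qed.

Lemma dotvZr {R : realType} {d : nat} (a : R) (x y : 'cV[R]_d) :
  dotv x (a *: y) = a * dotv x y.
Proof. by rewrite dotvC dotvZl dotvC. Qed.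

Lemma dotvNl {R : realType} {d : nat} (x y : 'cV[R]_d) :
  dotv (- x) y = - dotv x y.
Proof. by rewrite -scaleN1r dotvZl mulN1r. Qed.

Lemma dotvNr {R : realType} {d : nat} (x y : 'cV[R]_d) :
  dotv x (- y) = - dotv x y.
Proof. by rewrite dotvC dotvNl dotvC. Qed.

Definition dotvE := (@dotvDl, @dotvDr, @dotvNl, @dotvNr, @dotvZl, @dotvZr).

Lemma dotv0l {R : realType} {d : nat} (x : 'cV[R]_d) : dotv 0 x = 0.
Proof. by rewrite -(scale0r 0) dotvZl mul0r. Qed.

Lemma dotv_suml {R : realType} {d : nat} (I : Type) (r : seq I)
    (F : I -> 'cV[R]_d) (x : 'cV[R]_d) :
  dotv (\sum_(i <- r) F i) x = \sum_(i <- r) dotv (F i) x.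
Proof.
elim: r => [|i r IH]; first by rewrite !big_nil dotv0l.
by rewrite !big_cons dotvDl IH.
Qed.

Lemma dotv_mulmx {R : realType} {m d : nat} (A : 'M[R]_(m, d))
    (x : 'cV[R]_d) (y : 'cV[R]_m) :
  dotv (A *m x) y = dotv x (A^T *m y).
Proof.
rewrite /dotv; under eq_bigr do rewrite mxE mulr_suml.
rewrite exchange_big; apply: eq_bigr => j _ /=.
rewrite mxE mulr_sumr; apply: eq_bigr => i _; rewrite mxE; ring.
Qed.

Lemma sqnorm_ge0 {R : realType} {d : nat} (x : 'cV[R]_d) : 0 <= sqnorm x.
Proof. by apply: sumr_ge0 => j _; rewrite -expr2 sqr_ge0. Qed.

Lemma sqnorm_eq0 {R : realType} {d : nat} (x : 'cV[R]_d) :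
  (sqnorm x == 0) = (x == 0).
Proof.
apply/idP/eqP => [|->]; last by rewrite /sqnorm dotv0l.
rewrite psumr_eq0 => [/allP x0|j _]; last by rewrite -expr2 sqr_ge0.
apply/colP => j; have := x0 j (mem_index_enum _).
by rewrite mxE /= mulf_eq0 orbb => /eqP.
Qed.

Lemma sqnormN {R : realType} {d : nat} (x : 'cV[R]_d) : sqnorm (- x) = sqnorm x.
Proof. by rewrite /sqnorm !dotvE opprK. Qed.

Lemma sqnormZ {R : realType} {d : nat} (a : R) (x : 'cV[R]_d) :
  sqnorm (a *: x) = a ^+ 2 * sqnorm x.
Proof. by rewrite /sqnorm !dotvE mulrA. Qed.

Lemma sqnormD {R : realType} {d : nat} (x y : 'cV[R]_d) :
  sqnorm (x + y) = sqnorm x + 2 * dotv x y + sqnorm y.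
Proof. by rewrite /sqnorm !dotvE (dotvC y x); ring. Qed.

Lemma sqnormB {R : realType} {d : nat} (x y : 'cV[R]_d) :
  sqnorm (x - y) = sqnorm x - 2 * dotv x y + sqnorm y.
Proof. by rewrite sqnormD sqnormN dotvNr mulrN. Qed.

Lemma sqnormD_le {R : realType} {d : nat} (x y : 'cV[R]_d) :
  sqnorm (x + y) <= 2 * sqnorm x + 2 * sqnorm y.
Proof. by have := sqnorm_ge0 (x - y); rewrite sqnormB sqnormD; lra. Qed.

Lemma norm2_sq {R : realType} {d : nat} (x : 'cV[R]_d) : norm2 x ^+ 2 = sqnorm x.
Proof. exact/sqr_sqrtr/sqnorm_ge0. Qed.

(** Cauchy-Schwarz, from the nonnegativity of [sqnorm (sqnorm y *: x - dotv x y *: y)]; [y = 0] is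
    set apart so that [sqnorm y] can be cancelled. *)
Lemma dotv_le_norm2 {R : realType} {d : nat} (x y : 'cV[R]_d) :
  dotv x y <= norm2 x * norm2 y.
Proof.
have [y0|y0] := eqVneq (sqnorm y) 0.
  have /eqP -> : y == 0 by rewrite -sqnorm_eq0 y0.
  by rewrite dotvC dotv0l mulr_ge0 ?sqrtr_ge0.
have yp : 0 < sqnorm y by rewrite lt_neqAle eq_sym y0 sqnorm_ge0.
have sq : dotv x y ^+ 2 <= sqnorm x * sqnorm y.
  have := sqnorm_ge0 (sqnorm y *: x - dotv x y *: y).
  rewrite sqnormB !sqnormZ !dotvE => h.
  have : 0 <= sqnorm y * (sqnorm x * sqnorm y - dotv x y ^+ 2) by nra.
  by rewrite pmulr_rge0 // subr_ge0.
apply: le_trans (ler_norm _) _; rewrite -ler_sqr ?nnegrE ?mulr_ge0 ?sqrtr_ge0 //.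
by rewrite real_normK ?num_real // exprMn !norm2_sq.
Qed.

Lemma is_derive_line {R : realType} {d : nat} (f : 'cV[R]_d -> R)
    (g : 'cV[R]_d) (x h : 'cV[R]_d) (t : R) :
  differentiable f (x + t *: h) ->
  (forall u, 'd f (x + t *: h) u = dotv g u) ->
  is_derive t 1 (fun s => f (x + s *: h)) (dotv g h).
Proof.
move=> df dE; have dh : is_derive (x + t *: h) h f (dotv g h).
  by apply: DeriveDef; [exact: diff_derivable | rewrite deriveE].
have shiftE : (fun s : R => s^-1 *: (f (x + (s *: 1 + t) *: h) - f (x + t *: h)))
    = (fun s : R => s^-1 *: (f (s *: h + (x + t *: h)) - f (x + t *: h))).
  apply/funext => s; congr (_ *: (f _ - _)).
  by rewrite scalerDl [s *: 1]mulr1 addrCA.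
case: dh => cf <-.
by apply: DeriveDef; rewrite ?/derivable ?/derive /= shiftE.
Qed.

(** The chord slope [(f s - f 0) / s] is at most [f 1 - f 0]; let [s] tend to 0 from the right. *)
Lemma convex_tangent {R : realType} (f : R -> R) (D : R) :
  is_derive (0 : R) (1 : R) f D ->
  (forall t, 0 < t < 1 -> f t <= (1 - t) * f 0 + t * f 1) ->
  f 0 + D <= f 1.
Proof.
move=> fD fc.
have cv : (fun s => s^-1 *: (f (s *: (1 : R) + 0) - f 0)) @ (0 : R)^' --> D.
  by have <- := @derive_val _ _ _ _ _ _ _ fD; exact: ex_derive.
have {}cv := cvg_dnbhs_at_right cv.
rewrite addrC -lerBrDr; apply: cvgr_to_le cv _.
near=> s.
have s0 : 0 < s by near: s; exact: nbhs_right_gt.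
have s1 : s < 1 by near: s; exact: nbhs_right_lt.
have /= := fc s; rewrite s0 s1 => /(_ isT) h.
rewrite addr0 [s *: 1]mulr1 /GRing.scale /= mulrC ler_pdivrMr //; nra.
Unshelve. all: by end_near. Qed.

(** Mean value theorem for [f] minus [df 0 * t + L / 2 * t ^+ 2], whose derivative is nonpositive
    inside the unit interval. *)
Lemma descent_1d {R : realType} (f df : R -> R) (L : R) :
  (forall t : R, is_derive t (1 : R) f (df t)) ->
  (forall t, 0 < t < 1 -> df t <= df 0 + L * t) ->
  f 1 <= f 0 + df 0 + L / 2.
Proof.
move=> fd dfle.
pose g := fun t : R => f t - (df 0 * t + L / 2 * t ^+ 2).
have gd (t : R) : is_derive t (1 : R) g (df t - (df 0 + L * t)).
  have := fd t => fdt; rewrite /g.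
  apply: is_derive_eq; rewrite /GRing.scale /=; lra.
have [|c c01] := @MVT R g (fun t => df t - (df 0 + L * t)) 0 1 ltr01 (fun t _ => gd t).
  by apply: derivable_within_continuous => t _; exact: ex_derive.
have := dfle c; rewrite in_itv /= in c01; rewrite c01 => /(_ isT).
rewrite /g; lra.
Qed.

(** * Gradients of strongly convex functions *)

(** Phrased through restrictions to lines, so that tangent and descent bounds reduce to one-variable
    calculus. *)
Definition has_grad {R : realType} {d : nat} (f : 'cV[R]_d -> R)
    (g : 'cV[R]_d -> 'cV[R]_d) : Prop :=
  forall (x h : 'cV[R]_d) (t : R),
    is_derive t (1 : R) (fun s => f (x + s *: h)) (dotv (g (x + t *: h)) h).

Lemma has_grad_mean {R : realType} {n d : nat} (phi : nat -> 'cV[R]_d -> R)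
    (gphi : nat -> 'cV[R]_d -> 'cV[R]_d) :
  (forall i, (i < n)%N -> has_grad (phi i) (gphi i)) ->
  has_grad (fun x => n%:R^-1 * \sum_(i < n) phi i x) (full_grad n gphi).
Proof.
move=> Hphi x h t; rewrite /full_grad dotvZl dotv_suml.
have phid (i : 'I_n) := Hphi i (ltn_ord i) x h t.
have -> : (fun s : R => n%:R^-1 * \sum_(i < n) phi i (x + s *: h)) =
    n%:R^-1 \*: \sum_(i < n) (fun s : R => phi i (x + s *: h)).
  by apply/funext => s /=; rewrite fct_sumE.
exact: is_deriveZ.
Qed.

(** [convex_tangent] on the line from [x] to [x + h], for [f] minus its quadratic part [q]; the
    [t ^+ 2] term of [q] leaves the gain [nu / 2 * sqnorm h]. *)
Lemma strongly_convex_tangent {R : realType} {d : nat} (nu : R)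
    (f : 'cV[R]_d -> R) (g : 'cV[R]_d -> 'cV[R]_d) (x h : 'cV[R]_d) :
  strongly_convex nu f -> has_grad f g ->
  f x + dotv (g x) h + nu / 2 * sqnorm h <= f (x + h).
Proof.
move=> fc fg.
pose q := fun t : R => nu / 2 * (sqnorm x + 2 * dotv x h * t + sqnorm h * t ^+ 2).
have qE t : nu / 2 * sqnorm (x + t *: h) = q t.
  by rewrite /q sqnormD sqnormZ dotvZr; ring.
pose F := fun t : R => f (x + t *: h) - q t.
have Fd : is_derive (0 : R) (1 : R) F (dotv (g x) h - nu * dotv x h).
  have fd := fg x h 0; rewrite scale0r addr0 in fd.
  rewrite /F /q; apply: is_derive_eq; rewrite /GRing.scale /=; lra.
have Fc t : 0 < t < 1 -> F t <= (1 - t) * F 0 + t * F 1.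
  case/andP => t0 t1; have t01 : 0 <= t <= 1 by rewrite !ltW.
  have := fc (x + h) x t t01; rewrite /F -!qE scale0r scale1r addr0.
  have -> : t *: (x + h) + (1 - t) *: x = x + t *: h.
    by apply/colP => j; rewrite !mxE; ring.
  lra.
have := convex_tangent _ _ Fd Fc.
rewrite /F -!qE scale0r scale1r addr0 sqnormD; lra.
Qed.

(** Sum of the tangent inequalities at [x] and at [y]. *)
Lemma strong_monotone {R : realType} {d : nat} (nu : R)
    (f : 'cV[R]_d -> R) (g : 'cV[R]_d -> 'cV[R]_d) (x y : 'cV[R]_d) :
  strongly_convex nu f -> has_grad f g ->
  nu * sqnorm (x - y) <= dotv (g x - g y) (x - y).
Proof.
move=> fc fg.
have := strongly_convex_tangent _ _ _ x (y - x) fc fg.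
have := strongly_convex_tangent _ _ _ y (x - y) fc fg.
rewrite !subrKC -(opprB x y) sqnormN !dotvE.
lra.
Qed.

(** Along the line, Cauchy-Schwarz and the Lipschitz bound let the slope grow by at most
    [L * sqnorm h * t]. *)
Lemma descent {R : realType} {d : nat} (L : R) (f : 'cV[R]_d -> R)
    (g : 'cV[R]_d -> 'cV[R]_d) (x h : 'cV[R]_d) :
  has_grad f g ->
  (forall x y, norm2 (g x - g y) <= L * norm2 (x - y)) ->
  f (x + h) <= f x + dotv (g x) h + L / 2 * sqnorm h.
Proof.
move=> fg gL.
have := @descent_1d R _ (fun t => dotv (g (x + t *: h)) h) (L * sqnorm h) (fg x h).
rewrite /= scale0r scale1r addr0 mulrAC; apply => t /andP[t0 _].
rewrite -lerBlDl -dotvNl -dotvDl.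
apply: le_trans (dotv_le_norm2 _ _) _.
apply: le_trans (ler_wpM2r _ (gL _ _)) _; first exact: sqrtr_ge0.
rewrite addrC addKr /norm2 sqnormZ sqrtrM ?sqr_ge0 // sqrtr_sqr gtr0_norm //.
by rewrite -[sqnorm h in leRHS]norm2_sq /norm2 le_eqVlt; apply/orP; left; apply/eqP; ring.
Qed.

(* Baillon-Haddad: compare the tangent at [x] with the descent bound at [y], both
   evaluated at the gradient step [y - L^-1 (g y - g x)]. *)
Lemma cocoercive {R : realType} {d : nat} (nu L : R) (f : 'cV[R]_d -> R)
    (g : 'cV[R]_d -> 'cV[R]_d) (x y : 'cV[R]_d) :
  0 < nu -> 0 < L ->
  strongly_convex nu f -> has_grad f g ->
  (forall x y, norm2 (g x - g y) <= L * norm2 (x - y)) ->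
  sqnorm (g x - g y) <= L * dotv (g x - g y) (x - y).
Proof.
move=> nu0 L0 fc fg gL.
have half u v : f u + dotv (g u) (v - u) + L^-1 / 2 * sqnorm (g u - g v) <= f v.
  set w := L^-1 *: (g u - g v).
  have := strongly_convex_tangent _ _ _ u (v - u + w) fc fg.
  have := descent _ _ _ v w fg gL.
  rewrite addrA subrKC {2 3}/w sqnormZ !dotvE.
  have : 0 <= nu / 2 * sqnorm (v - u + w).
    by rewrite mulr_ge0 ?sqnorm_ge0 ?divr_ge0 ?ltW.
  have -> : L / 2 * (L^-1 ^+ 2 * sqnorm (g u - g v)) = L^-1 / 2 * sqnorm (g u - g v).
    by field; rewrite gt_eqF.
  have -> : sqnorm (g u - g v) =
      (dotv (g u) (g u) - dotv (g u) (g v)) - (dotv (g v) (g u) - dotv (g v) (g v)).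
    by rewrite /sqnorm !dotvE; ring.
  lra.
(* Adding both instances cancels the values of [f]. *)
have := half x y; have := half y x.
rewrite -(opprB x y) -(opprB (g x) (g y)) sqnormN !dotvE => h1 h2.
rewrite -ler_pdivrMl //; lra.
Qed.

(** * Existence and firm nonexpansiveness of the proximity operator *)

(* Otherwise the open sets [F z < F], [z] in [K], cover [K]; the point [z] of least
   value in a finite subcover then lies in some [F w < F] of that subcover. *)
Lemma lsc_attains_min {R : realType} {X : ptopologicalType} (F : X -> \bar R)
    (K : set X) :
  lower_semicontinuous F -> (forall x, F x != -oo%E) -> compact K -> K !=set0 ->
  exists2 z, K z & forall x, K x -> (F z <= F x)%E.
Proof.
move=> /lower_semicontinuousP Flsc Fny cK [x0 Kx0]; apply: contrapT => nomin.
have better x : K x -> exists2 z, K z & (F z < F x)%E.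
  move=> Kx; apply: contrapT => nb; apply: nomin; exists x => // z Kz.
  by rewrite leNgt; apply/negP => zx; apply: nb; exists z.
rewrite compact_cover in cK.
have [z _|x Kx|D' sD cov] := cK X K (fun z => [set y | (F z < F y)%E]).
(* When [F z] is [+oo] the set is empty, hence open. *)
- have := Fny z; rewrite /=; case: (F z) => [r _||//]; first exact: Flsc.
  rewrite (_ : mkset _ = set0) => [_|]; first exact: open0.
  by apply/seteqP; split => y /=; rewrite ltNge leey.
- by have [z Kz zx] := better x Kx; exists z.
have [i0 iD _] := cov x0 Kx0.
have [z _ zmin] := arg_minP (F \o val) (erefl : xpredT [` iD]%fset).
have Kz : K (val z) by exact/set_mem/sD/valP.
have [y Ky yz] := better _ Kz.
have [w wD /= wy] := cov y Ky.
have := lt_trans wy yz; rewrite ltNge => /negP; apply.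
exact: (zmin [` wD]%fset).
Qed.

Lemma sum_continuous {R : realType} {X : topologicalType} (I : Type) (r : seq I)
    (F : I -> X -> R) :
  (forall i, continuous (F i)) -> continuous (fun x => \sum_(i <- r) F i x).
Proof.
move=> Fc; apply: continuous_big => // -[a b].
by apply: (@cvgD _ R^o _ _ _ fst snd); [exact: cvg_fst | exact: cvg_snd].
Qed.

Lemma quadform_continuous {R : realType} {d : nat} (A : 'M[R]_d) :
  continuous (fun x : 'cV[R]_d => dotv (A *m x) x).
Proof.
apply: sum_continuous => i x; apply: continuousM; last exact: coord_continuous.
have -> : (fun x : 'cV[R]_d => (A *m x) i 0) = (fun x => \sum_j A i j * x j 0).
  by apply/funext => y; rewrite mxE.
apply: sum_continuous => j y.
by apply: continuousM; [exact: cst_continuous | exact: coord_continuous].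
Qed.

Lemma sqnorm_continuous {R : realType} {d : nat} :
  continuous (@sqnorm R d).
Proof.
have -> : @sqnorm R d = fun x => dotv (1%:M *m x) x.
  by apply/funext => x; rewrite mul1mx.
exact: quadform_continuous.
Qed.

Lemma sqdist_continuous {R : realType} {d : nat} (y : 'cV[R]_d) :
  continuous (fun x : 'cV[R]_d => sqnorm (x - y) / 2).
Proof.
have sqB : continuous (fun x : 'cV[R]_d => sqnorm (x - y)).
  move=> x; apply: continuous_comp; last exact: sqnorm_continuous.
  apply: (@continuousB R 'cV[R]_d _ id (cst y)); last exact: cst_continuous.
  by move=> A; apply.
by move=> x; exact: cvgM (sqB x) (cvg_cst _).
Qed.

Lemma trmx_continuous {R : realType} {m n : nat} :
  continuous (@trmx R m n).
Proof.
move=> M A [P MP PA]; exists (fun i j => P j i) => [i j|N PN].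
  by have := MP j i; rewrite mxE.
by apply: PA => i j; rewrite mxE; exact: PN.
Qed.

(** A box of row vectors is a compact product of segments; transposition carries it to columns. *)
Lemma compact_box {R : realType} {m : nat} (x0 : 'cV[R]_m) (r : R) :
  compact [set x : 'cV[R]_m | forall i, `|x i 0 - x0 i 0| <= r].
Proof.
pose K := [set v : 'rV[R]_m | forall i,
  `[x0 i 0 - r, x0 i 0 + r]%classic (v ord0 i)].
have cK : compact K.
  apply: (@rV_compact R m (fun i => `[x0 i 0 - r, x0 i 0 + r]%classic)) => i.
  exact: segment_compact.
have := continuous_compact (continuous_subspaceT (@trmx_continuous R 1 m)) cK.
congr compact; apply/seteqP; split => [x [v Kv <-] i|x Kx].
  by have := Kv i; rewrite mxE /= in_itv /= ler_distl.
exists x^T; last exact: trmxK.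
by move=> i; rewrite mxE /= in_itv /= -ler_distl.
Qed.

Lemma coord_le_sqnorm {R : realType} {d : nat} (x : 'cV[R]_d) (i : 'I_d) :
  x i 0 ^+ 2 <= sqnorm x.
Proof.
rewrite /sqnorm /dotv (bigD1 i) //= -expr2 lerDl.
by apply: sumr_ge0 => j _; rewrite -expr2 sqr_ge0.
Qed.

Lemma coord_le_norm2 {R : realType} {d : nat} (x : 'cV[R]_d) (i : 'I_d) :
  `|x i 0| <= norm2 x.
Proof.
by rewrite -ler_sqr ?nnegrE ?sqrtr_ge0 // norm2_sq real_normK ?num_real //
  coord_le_sqnorm.
Qed.

Lemma lscD_continuous {R : realType} {X : topologicalType} (f : X -> \bar R)
    (q : X -> R) :
  lower_semicontinuous f -> continuous q ->
  lower_semicontinuous (fun x => (f x + (q x)%:E)%E).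
Proof.
move=> fl qc x a afq.
(* A level [b] strictly between splits the claim: near [x], [f] stays above [b] and [q] above
   [a - b]. *)
have [b /andP[ab bf]] : exists b : R, (a - q x < b) && (b%:E < f x)%E.
  move: afq; case: (f x) => [r||//].
    rewrite -EFinD lte_fin => h; exists ((a - q x + r) / 2).
    by rewrite lte_fin; apply/andP; split; lra.
  by move=> _; exists (a - q x + 1); rewrite ltry ltrDl ltr01.
have [V xV Vf] := fl x b bf.
exists (V `&` [set y | a - b < q y]).
  apply: filterI => //; apply: cvgr_gt (qc x) _ _; lra.
move=> y [Vy /= qy]; have := Vf y Vy.
case: (f y) => [r||//]; last by rewrite addye ?ltry.
by rewrite -EFinD !lte_fin; lra.
Qed.

(** The argmin property itself, kept apart from the choice made by [Prox], so that it can be used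
    for any minimizer. *)
Definition is_prox {R : realType} {m : nat} (f : 'cV[R]_m -> \bar R)
    (y p : 'cV[R]_m) : Prop :=
  forall x, (f p + (sqnorm (p - y) / 2)%:E <= f x + (sqnorm (x - y) / 2)%:E)%E.

(* [f] is minorized by an affine function of the distance to a point [x0] of its
   domain, hence [f + |. - y|^2/2] is coercive and attains its minimum on a box. *)
Lemma prox_exists {R : realType} {m : nat} (f : 'cV[R]_m -> \bar R)
    (y : 'cV[R]_m) :
  proper_fun f -> convex_efun f -> lower_semicontinuous f ->
  exists p, is_prox f y p.
Proof.
move=> [fny [x0 fx0]] fc fl.
have [a fa] : exists a, f x0 = a%:E by exists (fine (f x0)); rewrite fineK.
pose box (r : R) := [set x : 'cV[R]_m | forall i, `|x i 0 - x0 i 0| <= r].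
have in_box r x : norm2 (x - x0) <= r -> box r x.
  by move=> h i; have := coord_le_norm2 (x - x0) i; rewrite !mxE => /le_trans; apply.
have x0_box (r : R) : 0 <= r -> box r x0 by move=> r0 i; rewrite subrr normr0.
have [z _ zmin] := lsc_attains_min f (box 1) fl fny (compact_box _ _)
  (ex_intro _ _ (x0_box _ ler01)).
have [b fb] : exists b, f z = b%:E.
  have := fny z; have := zmin _ (x0_box _ ler01); rewrite fa.
  by case: (f z) => [r _ _||//]; [exists r | rewrite leye_eq].
have ba : b <= a by have := zmin _ (x0_box _ ler01); rewrite fa fb lee_fin.
(* For [x] farther than 1 from [x0], the point of the segment at distance 1 from [x0] lies in the
   unit box, where [f] is at least [b]; convexity then bounds [f x] from below. *)
have minor x r : f x = r%:E -> a - (a - b) * (norm2 (x - x0) + 1) <= r.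
  move=> fx; have s0 : 0 <= norm2 (x - x0) by exact: sqrtr_ge0.
  have [s1|s1] := leP (norm2 (x - x0)) 1.
    by have := zmin _ (in_box _ _ s1); rewrite fb fx lee_fin; nra.
  set s := norm2 (x - x0) in s0 s1 *.
  have sgt0 : 0 < s by lra.
  have si01 : 0 < s^-1 < 1 by rewrite invr_gt0 sgt0 invf_lt1.
  have := fc x x0 s^-1 si01; rewrite fx fa -!EFinM -EFinD.
  have zle : (b%:E <= f (s^-1 *: x + (1 - s^-1) *: x0)%R)%E.
    rewrite -fb; apply: zmin; apply: in_box.
    have -> : s^-1 *: x + (1 - s^-1) *: x0 - x0 = s^-1 *: (x - x0).
      by apply/colP => j; rewrite !mxE; ring.
    by rewrite /norm2 sqnormZ sqrtrM ?sqr_ge0 // sqrtr_sqr -/(norm2 _) -/s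
      gtr0_norm ?invr_gt0 // mulVf ?gt_eqF.
  move/(le_trans zle); rewrite lee_fin => h.
  have : s * b <= r + (s - 1) * a.
    have -> : r + (s - 1) * a = s * (s^-1 * r + (1 - s^-1) * a).
      by field; rewrite gt_eqF.
    by rewrite ler_pM2l.
  nra.
pose F x := (f x + (sqnorm (x - y) / 2)%:E)%E.
have Fl : lower_semicontinuous F.
  by apply: lscD_continuous => //; exact: sqdist_continuous.
have Fny x : F x != -oo%E by have := fny x; rewrite /F; case: (f x).
pose c := sqnorm (x0 - y).
have c0 : 0 <= c by exact: sqnorm_ge0.
(* Beyond this radius, [s = norm2 (x - x0)] satisfies [s ^+ 2 / 4 >= (a - b) * (s + 1) + c], which
   with [minor] gives [F x0 <= F x]. *)
pose r := 4 * (2 * (a - b) + c + 1).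
have r0 : 0 <= r by rewrite /r; lra.
have [p _ pmin] := lsc_attains_min F (box r) Fl Fny (compact_box _ _)
  (ex_intro _ _ (x0_box _ r0)).
exists p => x; have [xr|xr] := leP (norm2 (x - x0)) r; first exact/pmin/in_box.
apply: le_trans (pmin _ (x0_box _ r0)) _; rewrite /F fa -/c.
have := fny x; case fx: (f x) => [t||//] _; last by rewrite leey.
rewrite -!EFinD lee_fin; have := minor _ _ fx.
have sE := norm2_sq (x - x0).
have := sqnormD_le (x - y) (y - x0); rewrite subrKA -sE.
rewrite -[sqnorm (y - x0)]sqnormN opprB -/c.
set s := norm2 (x - x0) in xr *; set q := sqnorm (x - y).
rewrite /r in xr; move=> h1 h2.
move: xr ba c0 h1 h2; move: (s : R) (q : R) (c : R); clear => s q c xr ba c0 h1 h2.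
have : s * (4 * (2 * (a - b) + c + 1)) <= s * s by rewrite ler_wpM2l //; lra.
nra.
Qed.

Lemma is_prox_Prox {R : realType} {m : nat} (f : 'cV[R]_m -> \bar R)
    (y : 'cV[R]_m) :
  (exists p, is_prox f y p) -> is_prox f y (Prox f y).
Proof. by move=> pex; have := xgetPex 0 pex. Qed.

Lemma is_prox_fin {R : realType} {m : nat} (f : 'cV[R]_m -> \bar R)
    (y p : 'cV[R]_m) :
  proper_fun f -> is_prox f y p -> f p \is a fin_num.
Proof.
move=> [fny [x fx]] /(_ x); have := fny p.
by move: fx; case: (f x) => //; case: (f p).
Qed.

(** First-order optimality: compare [p] with [t *: x + (1 - t) *: p], divide by [t], and make [t]
    small. *)
Lemma is_prox_subgrad {R : realType} {m : nat} (f : 'cV[R]_m -> \bar R)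
    (y p x : 'cV[R]_m) :
  proper_fun f -> convex_efun f -> is_prox f y p ->
  (f p + (dotv (y - p) (x - p))%:E <= f x)%E.
Proof.
move=> fp fc pP; have fin := is_prox_fin _ _ _ fp pP.
have [a fpa] : exists a, f p = a%:E by exists (fine (f p)); rewrite fineK.
have := fp.1 x; case fx: (f x) => [b||//] _; last by rewrite leey.
rewrite fpa -EFinD lee_fin -lerBrDl leNgt; apply/negP => gap.
set D := dotv (y - p) (x - p) in gap *.
pose q := sqnorm (x - p); have q0 : 0 <= q by exact: sqnorm_ge0.
have step t : 0 < t < 1 -> D <= b - a + t / 2 * q.
  move=> t01; have t0 : 0 < t by case/andP: t01.
  have := pP (t *: x + (1 - t) *: p); have := fc x p t t01.
  rewrite fx fpa; set u := (t *: x + (1 - t) *: p)%R => fu fpu.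
  have := le_trans fpu (leeD2r _ fu).
  rewrite -!EFinM -!EFinD lee_fin.
  have -> : u - y = t *: (x - p) - (y - p).
    by apply/colP => j; rewrite !mxE; ring.
  rewrite (sqnormB (t *: (x - p))) sqnormZ dotvZl (dotvC (x - p)) -/D -/q.
  rewrite -[sqnorm (p - y)]sqnormN opprB => h.
  have : t * D <= t * (b - a + t / 2 * q) by nra.
  by rewrite ler_pM2l.
(* In place of a limit, the explicit [t = e / (e + q + 1)] makes [t / 2 * q < e], contradicting
   [step]. *)
pose e := D - (b - a); have e0 : 0 < e by rewrite /e; lra.
have d0 : 0 < e + q + 1 by lra.
have t01 : 0 < e / (e + q + 1) < 1.
  by rewrite divr_gt0 //= ltr_pdivrMr // mul1r; lra.
have := step _ t01; rewrite leNgt => /negP; apply.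
suff : e / (e + q + 1) / 2 * q < e by rewrite /e; lra.
have -> : e / (e + q + 1) / 2 * q = e * (q / 2 / (e + q + 1)).
  by field; rewrite gt_eqF.
rewrite -[ltRHS]mulr1 ltr_pM2l // ltr_pdivrMr // mul1r; lra.
Qed.

(** The two subgradient inequalities add up to monotonicity, [0 <= dotv ((y1 - p1) - (y2 - p2)) (p1
    - p2)]; then split [y1 - y2] into residuals and proximal points. *)
Lemma prox_firm {R : realType} {m : nat} (f : 'cV[R]_m -> \bar R)
    (y1 y2 p1 p2 : 'cV[R]_m) :
  proper_fun f -> convex_efun f -> is_prox f y1 p1 -> is_prox f y2 p2 ->
  sqnorm ((y1 - p1) - (y2 - p2)) <= dotv ((y1 - p1) - (y2 - p2)) (y1 - y2).
Proof.
move=> fp fc P1 P2.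
have := is_prox_subgrad _ _ _ p2 fp fc P1.
have := is_prox_subgrad _ _ _ p1 fp fc P2.
have [/(is_prox_fin _ _ _ fp) + /(is_prox_fin _ _ _ fp)] := (P1, P2).
case: (f p1) => // a; case: (f p2) => // b _ _.
rewrite -!EFinD !lee_fin => h1 h2.
have -> : y1 - y2 = ((y1 - p1) - (y2 - p2)) + (p1 - p2).
  by apply/colP => j; rewrite !mxE; ring.
rewrite dotvDr lerDl.
have -> : dotv (y1 - p1 - (y2 - p2)) (p1 - p2) =
    - dotv (y1 - p1) (p2 - p1) - dotv (y2 - p2) (p1 - p2).
  by rewrite -(opprB p1 p2) dotvNr opprK dotvDl dotvNl.
lra.
Qed.

Lemma proper_scale {R : realType} {m : nat} (s : R) (f : 'cV[R]_m -> \bar R) :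
  0 < s -> proper_fun f -> proper_fun (fun u => s%:E * f u)%E.
Proof.
move=> s0 [fny [x fx]]; split; last by exists x; rewrite fin_numM.
by move=> z; have := fny z; case: (f z) => // _; rewrite gt0_muley ?lte_fin.
Qed.

Lemma convex_scale {R : realType} {m : nat} (s : R) (f : 'cV[R]_m -> \bar R) :
  0 < s -> proper_fun f -> convex_efun f -> convex_efun (fun u => s%:E * f u)%E.
Proof.
move=> s0 [fny _] fc x y t t01.
have := fc x y t t01; have := fny x; have := fny y.
have [t0 t1] := andP t01.
have t1' : 0 < 1 - t by lra.
case: (f x) => [a||//]; case: (f y) => [b||//] _ _;
  rewrite ?(gt0_muley, lte_fin) //= ?addey ?addye ?leey //.
rewrite -!EFinM -!EFinD; case: (f _) => [r||] //.
- by rewrite -!EFinM !lee_fin; nra.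
- by move=> _; rewrite gt0_muleNy ?lte_fin // leNye.
Qed.

Lemma lsc_scale {R : realType} {X : topologicalType} (s : R) (f : X -> \bar R) :
  0 < s -> lower_semicontinuous f -> lower_semicontinuous (fun u => s%:E * f u)%E.
Proof.
move=> s0 fl x a.
have scale z : (a%:E < s%:E * f z)%E = ((a / s)%:E < f z)%E.
  by rewrite EFinM lte_pdivrMr // muleC.
by rewrite scale => /fl [V xV Vf]; exists V => // y /Vf; rewrite scale.
Qed.

(** The substitution of [s *: u] for the variable multiplies the objective by [s ^+ 2]. This links
    the dilated function in the fixed-point equation to the scaled one in the algorithm. *)
Lemma is_prox_dilate {R : realType} {m : nat} (s : R) (f : 'cV[R]_m -> \bar R)
    (w p : 'cV[R]_m) :
  0 < s -> proper_fun f ->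
  is_prox (fun u => s%:E * f u)%E (s *: w) (s *: p) <->
  is_prox (fun u => s^-1%:E * f (s *: u)%R)%E w p.
Proof.
move=> s0 [fny _].
have eqv u : ((s%:E * f (s *: p)%R + (sqnorm (s *: p - s *: w) / 2)%:E <=
      s%:E * f (s *: u)%R + (sqnorm (s *: u - s *: w) / 2)%:E)%E) =
    ((s^-1%:E * f (s *: p)%R + (sqnorm (p - w) / 2)%:E <=
      s^-1%:E * f (s *: u)%R + (sqnorm (u - w) / 2)%:E)%E).
  rewrite -!scalerBr !sqnormZ.
  have := fny (s *: u); have := fny (s *: p).
  case: (f (s *: p)%R) => [a||//]; case: (f (s *: u)%R) => [b||//] _ _;
    rewrite ?gt0_muley ?lte_fin ?invr_gt0 // ?addye ?leey //.
  rewrite -!EFinM -!EFinD !lee_fin.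
  rewrite -[RHS](ler_pM2l (exprn_gt0 2 s0)).
  by congr (_ <= _); field; rewrite gt_eqF.
split=> P x; first by rewrite -eqv; exact: P.
by have := P (s^-1 *: x); rewrite -eqv scalerA divff ?gt_eqF // scale1r.
Qed.

(** * Rayleigh bounds and the deterministic step *)

(** With [w = S *m c], the form at [c - (a / (b + 1)) *: w] equals [- (a / (b + 1)) ^+ 2 * (b + 2)];
    nonnegativity forces [a = 0]. The shift [b + 1] covers [b = 0]. *)
Lemma psd_null {R : realType} {d : nat} (S : 'M[R]_d) (c : 'cV[R]_d) :
  S^T = S -> (forall y, 0 <= dotv (S *m y) y) -> dotv (S *m c) c = 0 ->
  S *m c = 0.
Proof.
move=> Ssym Spsd Sc; apply/eqP; rewrite -sqnorm_eq0.
set w := S *m c; set a := sqnorm w; pose b := dotv (S *m w) w.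
have a0 : 0 <= a by exact: sqnorm_ge0.
have b0 : 0 <= b by exact: Spsd.
have := Spsd (c - (a / (b + 1)) *: w).
rewrite mulmxBr -scalemxAr !dotvE Sc (dotv_mulmx S w c) Ssym -/w -/b.
rewrite -[dotv w w]/(sqnorm w) -/a => h.
have b1 : 0 < b + 1 by lra.
have : 0 <= - (a / (b + 1)) ^+ 2 * (b + 2).
  apply: le_trans h _; rewrite le_eqVlt; apply/orP; left; apply/eqP.
  by field; rewrite gt_eqF.
rewrite mulNr oppr_ge0 pmulr_lle0; last by lra.
rewrite le_eqVlt ltNge sqr_ge0 orbF sqrf_eq0 mulf_eq0 invr_eq0.
by rewrite (gt_eqF b1) orbF.
Qed.

(* The minimum of the Rayleigh quotient over the unit sphere is attained, and is an
   eigenvalue. *)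
Lemma rayleigh_ge {R : realType} {d : nat} (A : 'M[R]_d) (r : R) (x : 'cV[R]_d) :
  A^T = A -> (forall a, eigenvalue A a -> r <= a) ->
  r * sqnorm x <= dotv (A *m x) x.
Proof.
move=> Asym rmin; pose q (y : 'cV[R]_d) := dotv (A *m y) y.
have qZ a y : q (a *: y) = a ^+ 2 * q y.
  by rewrite /q -scalemxAr dotvZl dotvZr mulrA.
have [x0|x0] := eqVneq (sqnorm x) 0.
  have /eqP -> : x == 0 by rewrite -sqnorm_eq0 x0.
  by rewrite mulmx0 /sqnorm !dotv0l mulr0.
pose sphere := [set y : 'cV[R]_d | sqnorm y = 1].
have normalize y : sqnorm y != 0 -> sqnorm ((norm2 y)^-1 *: y) = 1.
  by move=> y0; rewrite sqnormZ exprVn norm2_sq mulVf.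
have cS : compact sphere.
  apply: (subclosed_compact _ (compact_box 0 1)) => [|y y1 i].
    apply: (@closed_comp _ _ (@sqnorm R d) [set 1]); last exact: closed_eq.
    by move=> y _; exact: sqnorm_continuous.
  rewrite mxE subr0; apply: le_trans (coord_le_norm2 y i) _.
  by rewrite /norm2 y1 sqrtr1.
have S0 : sphere !=set0 by exists ((norm2 x)^-1 *: x); exact: normalize.
have [c /set_mem c1 cmin] := compact_EVT_min S0 cS
  (continuous_subspaceT (quadform_continuous A)).
have {}cmin y : q c * sqnorm y <= q y.
  have [y0|y0] := eqVneq (sqnorm y) 0.
    have /eqP -> : y == 0 by rewrite -sqnorm_eq0 y0.
    by rewrite /q mulmx0 /sqnorm !dotv0l mulr0.
  have yp : 0 < sqnorm y by rewrite lt_neqAle eq_sym y0 sqnorm_ge0.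
  have : q c <= q ((norm2 y)^-1 *: y) by apply/cmin/mem_set; exact: normalize.
  by rewrite qZ exprVn norm2_sq ler_pdivlMl // mulrC.
(* [S] is positive semidefinite and its form vanishes at the minimizer [c], so [psd_null] makes [c]
   an eigenvector. *)
pose S := A - (q c)%:M.
have SE y : dotv (S *m y) y = q y - q c * sqnorm y.
  by rewrite mulmxBl mul_scalar_mx dotvDl dotvNl dotvZl.
have Sc : S *m c = 0.
  apply: psd_null => [|y|]; first by rewrite linearB /= Asym tr_scalar_mx.
    by rewrite SE subr_ge0.
  by rewrite SE c1 mulr1 subrr.
apply: le_trans (cmin x); rewrite ler_pM2r; last first.
  by rewrite lt_neqAle eq_sym x0 sqnorm_ge0.
(* [eigenvalue] refers to row vectors acted on from the right; symmetry of [A] allows the transpose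
   of [c]. *)
apply/rmin/eigenvalueP; exists c^T.
  apply: trmx_inj; rewrite trmx_mul trmxK Asym linearZ /= trmxK.
  by apply/eqP; rewrite -subr_eq0 -mul_scalar_mx -mulmxBl; apply/eqP.
rewrite -trmx0 (inj_eq trmx_inj) -sqnorm_eq0.
by rewrite [sqnorm c]c1 oner_eq0.
Qed.

Lemma rayleigh_le {R : realType} {d : nat} (A : 'M[R]_d) (r : R) (x : 'cV[R]_d) :
  A^T = A -> (forall a, eigenvalue A a -> a <= r) ->
  dotv (A *m x) x <= r * sqnorm x.
Proof.
move=> Asym rmax; rewrite -lerN2 -dotvNl -mulNmx -mulNr; apply: rayleigh_ge.
  by rewrite linearN /= Asym.
move=> a /eigenvalueP[v vA v0]; rewrite lerNl; apply/rmax/eigenvalueP.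
by exists v => //; rewrite scaleNr -vA mulmxN opprK.
Qed.

(* The cross terms combine into [<M (u - u'), u - u'>] with [M = I - lam B B^T],
   which is nonnegative because [lam < 1 / rmax]. *)
Lemma primal_dual_contraction {R : realType} {m d : nat} (B : 'M[R]_(m, d))
    (lam rmax rmin : R) (e : 'cV[R]_d) (u u' : 'cV[R]_m) :
  is_max_eigenvalue (B *m B^T) rmax -> is_min_eigenvalue (B *m B^T) rmin ->
  0 < lam < rmax^-1 ->
  sqnorm u' <= dotv u' (B *m e + (1%:M - lam *: (B *m B^T)) *m u) ->
  sqnorm (e - lam *: (B^T *m u')) + lam * sqnorm u' <=
  sqnorm e + (1 - lam * rmin) * (lam * sqnorm u).
Proof.
move=> [_ rmaxP] [_ rminP] /andP[lam0 lamr].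
set A := B *m B^T; have Asym : A^T = A by rewrite trmx_mul trmxK.
rewrite mulmxBl mul1mx -scalemxAl !dotvE => firm.
have rmax0 : 0 < rmax by rewrite -invr_gt0; exact: lt_trans lamr.
have lamr1 : lam * rmax < 1 by rewrite -ltr_pdivlMr // div1r.
have := rayleigh_le A rmax (u - u') Asym rmaxP.
have := rayleigh_ge A rmin u Asym rminP.
rewrite !sqnormB sqnormZ mulmxBr !dotvE (dotv_mulmx A u u') Asym.
rewrite (dotvC e) (dotv_mulmx B^T u' e) trmxK.
have -> : sqnorm (B^T *m u') = dotv (A *m u') u'.
  by rewrite -mulmxA dotv_mulmx.
have uAu' : dotv u' (A *m u) = dotv (A *m u') u by rewrite dotv_mulmx Asym.
rewrite uAu' in firm; rewrite (dotvC u (A *m u')) (dotvC u u') => minP maxP.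
have D0 := sqnorm_ge0 (u - u'); rewrite sqnormB (dotvC u u') in D0.
move: firm minP maxP D0.
set U := sqnorm u; set U' := sqnorm u'; set Q := dotv (A *m u) u.
set Q' := dotv (A *m u') u'; set X := dotv (A *m u') u; set P := dotv u' u.
set E := dotv u' (B *m e) => firm minP maxP D0.
have lamP : lam * (Q - X - (X - Q')) <= U - 2 * P + U'.
  apply: (@le_trans _ _ (lam * rmax * (U - 2 * P + U'))).
    by rewrite -mulrA ler_pM2l.
  by rewrite ler_piMl // ltW.
(* The bound is twice [lam] times [firm], plus [lam] times [lamP], plus [lam ^+ 2] times [minP]. *)
have := ler_wpM2l (ltW lam0) firm; have := ler_wpM2l (ltW lam0) lamP.
have := ler_wpM2l (sqr_ge0 lam) minP; lra.
Qed.

(** Scaled by [tau = g / lam], both [v'] and [vs] become residuals of the proximity operator of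
    [tau] times [f1], at [w] and [tau *: ws]. Firm nonexpansiveness then feeds
    [primal_dual_contraction] with [u = tau *: (v - vs)] and [u' = tau *: (v' - vs)]. *)
Lemma pd_step {R : realType} {m d : nat} (f1 : 'cV[R]_m -> \bar R)
    (B : 'M[R]_(m, d)) (lam rmax rmin g : R) (x xs G H : 'cV[R]_d)
    (v vs w ws v' : 'cV[R]_m) :
  proper_fun f1 -> convex_efun f1 -> lower_semicontinuous f1 ->
  is_max_eigenvalue (B *m B^T) rmax -> is_min_eigenvalue (B *m B^T) rmin ->
  0 < lam < rmax^-1 -> 0 < g ->
  ws = (lam / g) *: (B *m (xs - g *: H)) + (1%:M - lam *: (B *m B^T)) *m vs ->
  vs = ws - Prox (fun u => (lam / g)%:E * f1 ((g / lam) *: u)%R)%E ws ->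
  xs = xs - g *: H - g *: (B^T *m vs) ->
  w = B *m (x - g *: G) + (1%:M - lam *: (B *m B^T)) *m ((g / lam) *: v) ->
  v' = (lam / g) *: (w - Prox (fun u => (g / lam)%:E * f1 u)%E w) ->
  sqnorm (x - g *: G - g *: (B^T *m v') - xs) + g ^+ 2 / lam * sqnorm (v' - vs) <=
  sqnorm (x - xs - g *: (G - H)) +
    (1 - lam * rmin) * (g ^+ 2 / lam * sqnorm (v - vs)).
Proof.
move=> fp fc fl rmaxP rminP lamP g0 wsE vsE xsE wE v'E.
have lam0 : 0 < lam by case/andP: lamP.
have glam : lam / g = (g / lam)^-1 by rewrite invf_div.
set tau := g / lam in glam wE v'E vsE *.
have tau0 : 0 < tau by rewrite divr_gt0.
have hex y : exists p, is_prox (fun u => tau%:E * f1 u)%E y p.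
  by apply: prox_exists;
    [exact: proper_scale | exact: convex_scale | exact: lsc_scale].
rewrite glam in vsE wsE v'E.
set ps := Prox _ ws in vsE.
have psP : is_prox (fun u => tau%:E * f1 u)%E (tau *: ws) (tau *: ps).
  apply: (is_prox_dilate _ _ _ _ tau0 fp).2; apply: is_prox_Prox.
  have [p pP] := hex (tau *: ws); exists (tau^-1 *: p).
  apply: (is_prox_dilate _ _ _ _ tau0 fp).1.
  by rewrite scalerA divff ?gt_eqF // scale1r.
have := prox_firm _ _ _ _ _ (proper_scale _ _ tau0 fp)
  (convex_scale _ _ tau0 fp fc) (is_prox_Prox _ _ (hex w)) psP.
have -> : w - Prox (fun u => tau%:E * f1 u)%E w = tau *: v'.
  by rewrite v'E scalerA divff ?gt_eqF // scale1r.
rewrite -scalerBr -vsE -scalerBr.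
have -> : w - tau *: ws = B *m (x - xs - g *: (G - H)) +
    (1%:M - lam *: (B *m B^T)) *m (tau *: (v - vs)).
  rewrite wE wsE scalerDr scalerA divff ?gt_eqF // scale1r !(scalemxAr tau).
  rewrite opprD addrACA -!mulmxBr -scalerBr; congr (B *m _ + _).
  by apply/colP => j; rewrite !mxE; ring.
move/(primal_dual_contraction _ _ _ _ _ _ _ rmaxP rminP lamP).
rewrite !sqnormZ -scalemxAr scalerA.
(* The identities [lam * tau = g] and [lam * tau ^+ 2 = g ^+ 2 / lam] restore the weights of the
   statement. *)
have -> : lam * tau = g by rewrite mulrC divfK ?gt_eqF.
have scaleE (r : R) : lam * (tau ^+ 2 * r) = g ^+ 2 / lam * r.
  by rewrite /tau; field; rewrite gt_eqF.
rewrite !scaleE; congr (sqnorm _ + _ <= _).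
rewrite mulmxBr {2}xsE; apply/colP => j; rewrite !mxE; ring.
Qed.

(** * Expectation over the drawn batches *)

Lemma sum_tuple_rcons {R : realType} {T : finType} (k : nat) (F : seq T -> R) :
  \sum_(t : k.+1.-tuple T) F t =
  \sum_(s : k.-tuple T) \sum_(j : T) F (rcons s j).
Proof.
rewrite pair_big /=.
rewrite (reindex (fun sj : k.-tuple T * T => [tuple of rcons sj.1 sj.2])) //=.
apply/onW_bij/inj_card_bij => [[s i] [t j] /(congr1 val) /rcons_inj [/val_inj -> ->] //|].
by rewrite card_prod !card_tuple expnSr.
Qed.

(** Tower property: condition on all draws but the last. The index is [k.+2] because [Ek N k]
    averages over [k.-1] draws. *)
Lemma EkS {R : realType} (N k : nat) (F : seq nat -> R) :
  Ek N k.+2 F =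
  Ek N k.+1 (fun s => N%:R^-1 * \sum_(j < N) F (rcons s j)).
Proof.
rewrite /Ek /= (sum_tuple_rcons k (fun s => F (map val s))) -mulr_sumr mulrA.
rewrite exprSr invfM; congr (_ * _); apply: eq_bigr => s _.
by apply: eq_bigr => j _; rewrite map_rcons.
Qed.

Lemma ler_Ek {R : realType} (N k : nat) (F G : seq nat -> R) :
  (forall s, size s = k -> F s <= G s) -> Ek N k.+1 F <= Ek N k.+1 G.
Proof.
move=> FG; apply: ler_wpM2l; first by rewrite invr_ge0 exprn_ge0.
by apply: ler_sum => s _; apply: FG; rewrite size_map size_tuple.
Qed.

Lemma EkD {R : realType} (N k : nat) (F G : seq nat -> R) :
  Ek N k (fun s => F s + G s) = Ek N k F + Ek N k G.
Proof. by rewrite /Ek big_split mulrDr. Qed.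

Lemma EkZ {R : realType} (N k : nat) (a : R) (F : seq nat -> R) :
  Ek N k (fun s => a * F s) = a * Ek N k F.
Proof. by rewrite /Ek -mulr_sumr mulrCA. Qed.

Lemma Ek_cst {R : realType} (N k : nat) (a : R) :
  (0 < N)%N -> Ek N k (fun=> a) = a.
Proof.
move=> N0; rewrite /Ek sumr_const card_tuple card_ord -(mulr_natl a) natrX mulrA.
by rewrite mulVf ?mul1r // expf_neq0 // pnatr_eq0 -lt0n.
Qed.

Lemma sum_ord_mul {V : nmodType} (N p : nat) (F : nat -> V) :
  \sum_(i < N * p) F i = \sum_(j < N) \sum_(l < p) F (j * p + l)%N.
Proof.
elim: N => [|N IH]; first by rewrite !big_ord0.
rewrite big_ord_recr -IH mulSnr /= big_split_ord /=.
by congr (_ + _); apply: eq_bigr.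
Qed.

(** Unbiasedness of the sampled gradient: since [p] divides [n], the batches tile the indices below
    [n]. *)
Lemma mean_batch_grad {R : realType} {d : nat} (n p : nat)
    (gphi : nat -> 'cV[R]_d -> 'cV[R]_d) (x : 'cV[R]_d) :
  (p %| n)%N ->
  ((n %/ p)%:R)^-1 *: \sum_(j < n %/ p) batch_grad p gphi j x = full_grad n gphi x.
Proof.
move=> pn; rewrite /batch_grad -scaler_sumr scalerA -invfM -natrM divnK //.
rewrite -(sum_ord_mul _ _ (gphi^~ x)) /full_grad; congr (_ *: _).
by rewrite divnK.
Qed.

(** Bias-variance decomposition: deviations from the mean [Gm] sum to zero, so the cross term
    vanishes. *)
Lemma mean_sqnorm {R : realType} {d : nat} (N : nat) (G : nat -> 'cV[R]_d)
    (D H Gm : 'cV[R]_d) (g : R) :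
  (0 < N)%N -> N%:R^-1 *: \sum_(j < N) G j = Gm ->
  N%:R^-1 * \sum_(j < N) sqnorm (D - g *: (G j - H)) =
  sqnorm (D - g *: (Gm - H)) +
    g ^+ 2 * (N%:R^-1 * \sum_(j < N) sqnorm (G j - Gm)).
Proof.
move=> N0 GmE; have N0' : N%:R != 0 :> R by rewrite pnatr_eq0 -lt0n.
pose A := D - g *: (Gm - H).
have -> : \sum_(j < N) sqnorm (D - g *: (G j - H)) = \sum_(j < N)
    ((sqnorm A - 2 * g * dotv (G j - Gm) A) + g ^+ 2 * sqnorm (G j - Gm)).
  apply: eq_bigr => j _.
  have -> : D - g *: (G j - H) = A - g *: (G j - Gm).
    by apply/colP => i; rewrite !mxE; ring.
  by rewrite (sqnormB A) sqnormZ dotvZr dotvC mulrA.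
have centered : \sum_(j < N) dotv (G j - Gm) A = 0.
  rewrite -dotv_suml sumrB sumr_const card_ord.
  by rewrite -GmE -scaler_nat scalerA divff // scale1r subrr dotv0l.
rewrite big_split /= sumrB -!mulr_sumr centered mulr0 subr0 sumr_const card_ord.
by rewrite mulrDr -(mulr_natl (sqnorm A)) mulrA mulVf // mul1r mulrCA.
Qed.

(** * Step sizes, iterates and the recursion for the expected error *)

Lemma gamma_gt0 {R : realType} (c alpha : R) (k : nat) :
  0 < c -> (0 < k)%N -> 0 < gamma c alpha k.
Proof. by move=> c0 k0; rewrite divr_gt0 ?powR_gt0 ?ltr0n. Qed.

Lemma gamma_noninc {R : realType} (c alpha : R) (j k : nat) :
  0 < c -> 0 < alpha -> (0 < j)%N -> (j <= k)%N ->
  gamma c alpha k <= gamma c alpha j.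
Proof.
move=> c0 a0 j0 jk; rewrite ler_pM2l // lef_pV2 ?posrE ?powR_gt0 ?ltr0n //.
  by rewrite ge0_ler_powR ?nnegrE ?ler_nat // ltW.
exact: leq_trans jk.
Qed.

(** [alg_run] consumes draws from the head, whereas conditioning isolates the last one. Steps are
    numbered from 1, hence [(size s).+1]. *)
Lemma iterate_rcons {R : realType} (p d m : nat)
    (gphi : nat -> 'cV[R]_d -> 'cV[R]_d) (f1 : 'cV[R]_m -> \bar R)
    (B : 'M[R]_(m, d)) (c alpha lam : R) (x1 : 'cV[R]_d) (v1 : 'cV[R]_m)
    (s : seq nat) (j : nat) :
  iterate p gphi f1 B c alpha lam x1 v1 (rcons s j) =
  alg_step p gphi f1 B c alpha lam (size s).+1
    (iterate p gphi f1 B c alpha lam x1 v1 s) j.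
Proof.
have run k st : alg_run p gphi f1 B c alpha lam k st (rcons s j) =
    alg_step p gphi f1 B c alpha lam (k + size s)
      (alg_run p gphi f1 B c alpha lam k st s) j.
  elim: s k st => [|i s IH] k st; first by rewrite [size _]/= addn0.
  by rewrite [size _]/= -addSnnS; exact: IH.
exact: run.
Qed.

(** Here [G] is the squared gradient gap, [D] its inner product with [x - xs], and [q] the squared
    distance. Cocoercivity, monotonicity and the step size give [g ^+ 2 * G + 2 * C1 * g ^+ 2 * q <=
    g * D / 2]; the remaining multiple of [g * D] dominates [nu * g * q]. *)
Lemma step_size_bound {R : realType} (g nu beta C1 D G q : R) :
  0 < g -> 0 < nu -> 0 < beta -> 0 < C1 -> 0 <= q ->
  g <= beta * nu / (2 * (nu + 2 * C1 * beta)) ->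
  nu * q <= D -> beta * G <= D ->
  g ^+ 2 * G - 2 * g * D <= - (nu * g + 2 * C1 * g ^+ 2) * q.
Proof.
move=> g0 nu0 b0 C0 q0 gle mono coco.
have D0 : 0 <= D by apply: le_trans mono; rewrite mulr_ge0 // ltW.
have bn0 : 0 < beta * nu by rewrite mulr_gt0.
have Cb : 0 < C1 * beta by rewrite mulr_gt0.
have gle' : g * (2 * (nu + 2 * C1 * beta)) <= beta * nu.
  by rewrite -ler_pdivlMr //; lra.
have key : beta * nu * (g ^+ 2 * G + 2 * C1 * g ^+ 2 * q) <=
    beta * nu * (g * D / 2).
  apply: (@le_trans _ _ (g ^+ 2 * ((nu + 2 * C1 * beta) * D))).
    have -> : beta * nu * (g ^+ 2 * G + 2 * C1 * g ^+ 2 * q) =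
        g ^+ 2 * (nu * (beta * G) + 2 * (C1 * beta) * (nu * q)) by ring.
    apply: ler_wpM2l; first exact: sqr_ge0.
    have := ler_wpM2l (ltW nu0) coco; have := ler_wpM2l (ltW Cb) mono; lra.
  have -> : g ^+ 2 * ((nu + 2 * C1 * beta) * D) =
      (g * D / 2) * (g * (2 * (nu + 2 * C1 * beta))) by field.
  by rewrite [leRHS]mulrC ler_wpM2l // divr_ge0 // mulr_ge0 // ltW.
move: key; rewrite ler_pM2l // => key.
have := ler_wpM2l (ltW g0) mono; have := mulr_ge0 (ltW g0) D0; lra.
Qed.

Theorem theorem4p8 (R : realType) (n p d m : nat)
  (Hn : (0 < n)%N) (Hp : (0 < p)%N) (Hpn : (p %| n)%N)
  (f1 : 'cV[R]_m -> \bar R)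
  (Hf1_proper : proper_fun f1) (Hf1_convex : convex_efun f1)
  (Hf1_lsc : lower_semicontinuous f1)
  (B : 'M[R]_(m, d)) (HB : row_free B)
  (phi : nat -> 'cV[R]_d -> R) (gphi : nat -> 'cV[R]_d -> 'cV[R]_d)
  (Hphi_diff : forall i, (i < n)%N -> forall x : 'cV[R]_d,
      differentiable (phi i) x /\ forall h, 'd (phi i) x h = dotv (gphi i x) h)
  (Hphi_convex : forall i, (i < n)%N -> convex_rfun (phi i))
  (nu beta : R) (Hnu : 0 < nu) (Hbeta : 0 < beta)
  (Hf2_sc : strongly_convex nu (fun x => n%:R^-1 * \sum_(i < n) phi i x))
  (Hf2_lip : forall x y : 'cV[R]_d,
      norm2 (full_grad n gphi x - full_grad n gphi y) <= beta^-1 * norm2 (x - y))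
  (xs : 'cV[R]_d)
  (Hxs : forall x : 'cV[R]_d,
      (f1 (B *m xs) + (n%:R^-1 * \sum_(i < n) phi i xs)%:E
        <= f1 (B *m x) + (n%:R^-1 * \sum_(i < n) phi i x)%:E)%E)
  (c alpha lam : R) (Hc : 0 < c) (Halpha : 0 < alpha <= 1)
  (rho_max rho_min : R)
  (Hrmax : is_max_eigenvalue (B *m B^T) rho_max)
  (Hrmin : is_min_eigenvalue (B *m B^T) rho_min)
  (Hlam : 0 < lam < rho_max^-1)
  (vs : 'cV[R]_m)
  (Hvs : forall k : nat, (0 < k)%N ->
      let g := gamma c alpha k in
      let w := (lam / g) *: (B *m (xs - g *: full_grad n gphi xs))
               + (1%:M - lam *: (B *m B^T)) *m vs in
      vs = w - Prox (fun u => ((lam / g)%:E * f1 ((g / lam) *: u))%E) w)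
  (Hxs_fix : forall k : nat, (0 < k)%N ->
      let g := gamma c alpha k in
      xs = xs - g *: full_grad n gphi xs - g *: (B^T *m vs))
  (x1 : 'cV[R]_d) (v1 : 'cV[R]_m)
  (C1 C2 : R) (HC1 : 0 < C1) (HC2 : 0 < C2)
  (Hvar : forall k : nat, (0 < k)%N ->
      let X := fun s => (iterate p gphi f1 B c alpha lam x1 v1 s).1 in
      Ek (n %/ p) k.+1 (fun s =>
          sqnorm (batch_grad p gphi (nth 0%N s k.-1) (X (take k.-1 s))
                  - full_grad n gphi (X (take k.-1 s))))
        <= C1 * Ek (n %/ p) k (fun s => sqnorm (X s)) + C2)
  (k0 : nat) (Hk0 : (0 < k0)%N)
  (Hgk0 : gamma c alpha k0 <=
      Num.min (beta * nu / (2 * (nu + 2 * C1 * beta))) (lam * rho_min / nu)) :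
  let X := fun s => (iterate p gphi f1 B c alpha lam x1 v1 s).1 in
  let V := fun s => (iterate p gphi f1 B c alpha lam x1 v1 s).2 in
  let a := fun k : nat => Ek (n %/ p) k (fun s =>
      sqnorm (X s - xs) + (gamma c alpha k) ^+ 2 / lam * sqnorm (V s - vs)) in
  let M1 := 4 * C1 * sqnorm xs + 2 * C2 in
  forall k : nat, (k0 <= k)%N ->
    a k.+1 <= (1 - nu * gamma c alpha k) * a k + (gamma c alpha k) ^+ 2 * M1.
Proof.
move=> X V a M1 k k0k.
have kpos : (0 < k)%N by exact: leq_trans k0k.
case: k kpos k0k => // K _ k0K.
set N := (n %/ p)%N in Hvar a *.
have N0 : (0 < N)%N by rewrite divn_gt0 // dvdn_leq.
have N0' : N%:R != 0 :> R by rewrite pnatr_eq0 -lt0n.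
have alpha0 : 0 < alpha by case/andP: Halpha.
have lam0 : 0 < lam by case/andP: Hlam.
set g := gamma c alpha K.+1.
have g0 : 0 < g by exact: gamma_gt0.
have gS0 : 0 < gamma c alpha K.+2 by exact: gamma_gt0.
have gS : gamma c alpha K.+2 <= g by exact: gamma_noninc.
have gk0 : g <= gamma c alpha k0 by exact: gamma_noninc.
have [gle1 gle2] : g <= beta * nu / (2 * (nu + 2 * C1 * beta)) /\
    g <= lam * rho_min / nu.
  by move: Hgk0; rewrite le_min => /andP[h1 h2]; split; exact: le_trans gk0 _.
pose f2 x := n%:R^-1 * \sum_(i < n) phi i x.
have f2_grad : has_grad f2 (full_grad n gphi).
  apply: has_grad_mean => i /Hphi_diff di x h t.
  by have [dif difE] := di (x + t *: h); exact: is_derive_line.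
pose H := full_grad n gphi xs.
pose Var s := N%:R^-1 *
  \sum_(j < N) sqnorm (batch_grad p gphi j (X s) - full_grad n gphi (X s)).
pose q s := sqnorm (X s - xs).
pose r s := g ^+ 2 / lam * sqnorm (V s - vs).
have q0 s : 0 <= q s by exact: sqnorm_ge0.
have r0 s : 0 <= r s by rewrite mulr_ge0 ?sqnorm_ge0 // divr_ge0 ?sqr_ge0 // ltW.
have step s j : size s = K ->
    sqnorm (X (rcons s j) - xs) +
      gamma c alpha K.+2 ^+ 2 / lam * sqnorm (V (rcons s j) - vs) <=
    sqnorm (X s - xs - g *: (batch_grad p gphi j (X s) - H)) +
      (1 - lam * rho_min) * r s.
  move=> sK.
  apply: le_trans (pd_step f1 B lam rho_max rho_min g (X s) xs
    (batch_grad p gphi j (X s)) H (V s) vs _ _ _ Hf1_proper Hf1_convex Hf1_lsc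
    Hrmax Hrmin Hlam g0 erefl (Hvs K.+1 isT) (Hxs_fix K.+1 isT) erefl erefl).
  (* The new error carries the next step size in its weight; step sizes do not increase, so [g] may
     replace it. *)
  rewrite /X /V iterate_rcons sK lerD2l.
  apply: ler_wpM2r; first exact: sqnorm_ge0.
  by rewrite ler_pM2r ?invr_gt0 // ler_sqr ?nnegrE // ltW.
(* Average over the last draw only. The term [- (2 * C1 * g ^+ 2) * q s] is held back to absorb the
   variance. *)
have avg (s : seq nat) : size s = K ->
    N%:R^-1 * \sum_(j < N) (sqnorm (X (rcons s j) - xs) +
      gamma c alpha K.+2 ^+ 2 / lam * sqnorm (V (rcons s j) - vs)) <=
    (1 - nu * g) * (q s + r s) + (- (2 * C1 * g ^+ 2) * q s + g ^+ 2 * Var s).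
  move=> sK; set D := X s - xs; set Gx := full_grad n gphi (X s).
  have mean := mean_sqnorm N (fun j => batch_grad p gphi j (X s)) D H Gx g N0
    (mean_batch_grad n p gphi (X s) Hpn).
  apply: (@le_trans _ _ (N%:R^-1 * \sum_(j < N)
      (sqnorm (D - g *: (batch_grad p gphi j (X s) - H)) +
       (1 - lam * rho_min) * r s))).
    apply: ler_wpM2l; first by rewrite invr_ge0.
    by apply: ler_sum => j _; exact: step.
  rewrite big_split mulrDr mean sumr_const card_ord -(mulr_natl (_ * r s)).
  rewrite mulKf // sqnormB sqnormZ dotvZr.
  have coco : beta * sqnorm (Gx - H) <= dotv (Gx - H) D.
    have := cocoercive _ _ _ _ (X s) xs Hnu _ Hf2_sc f2_grad Hf2_lip.
    by rewrite invr_gt0 => /(_ Hbeta); rewrite -ler_pdivrMl ?invr_gt0 // invrK.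
  have mono := strong_monotone _ _ _ (X s) xs Hf2_sc f2_grad.
  have := step_size_bound g nu beta C1 _ _ _ g0 Hnu Hbeta HC1 (q0 s) gle1 mono coco.
  (* The second bound on the step size enters here, as [nu * g <= lam * rho_min]. *)
  have : (1 - lam * rho_min) * r s <= (1 - nu * g) * r s.
    apply: ler_wpM2r => //; rewrite lerD2l lerN2 mulrC.
    by rewrite -ler_pdivlMr.
  rewrite (dotvC D) -/D -/Gx -/H -[sqnorm D]/(q s) -/(Var s); lra.
(* Unfolding the last draw in [Hvar] yields [Var]; the second moment of [X s] is then recentred at
   [xs] by [sqnormD_le]. *)
have EVar : Ek N K.+1 Var <= C1 * (2 * Ek N K.+1 q + 2 * sqnorm xs) + C2.
  apply: le_trans (le_trans _ (Hvar K.+1 isT)) _.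
    rewrite EkS; apply: ler_Ek => s sK; rewrite /Var.
    apply: ler_wpM2l; first by rewrite invr_ge0.
    apply: ler_sum => j _.
    by rewrite nth_rcons -cats1 sK ltnn eqxx take_size_cat.
  rewrite lerD2r ler_pM2l // -EkZ -(Ek_cst N K.+1 (2 * sqnorm xs) N0) -EkD.
  apply: ler_Ek => s _.
  by rewrite -[X in sqnorm X](subrK xs); exact: sqnormD_le.
rewrite /a EkS; apply: le_trans (ler_Ek _ _ _ _ avg) _.
rewrite (EkD _ _ (fun s => (1 - nu * g) * (q s + r s))) (EkZ _ _ (1 - nu * g)).
rewrite lerD2l EkD (EkZ _ _ _ q) (EkZ _ _ _ Var).
(* The multiples of [Ek N K.+1 q] cancel, leaving [g ^+ 2 * (2 * C1 * sqnorm xs + C2)], half of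
   [g ^+ 2 * M1]; the two nonnegative terms below supply the slack. *)
have := ler_wpM2l (sqr_ge0 g) EVar.
have := mulr_ge0 (sqr_ge0 g) (ltW HC2).
have := mulr_ge0 (sqr_ge0 g) (mulr_ge0 (ltW HC1) (sqnorm_ge0 xs)).
rewrite /M1; lra.
Qed.
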